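(* There is an absolute constant $C>0$ such that for every prime power $q$ and all integers $n\ge 2$ and $m\ge 1$ with $n\ge m\ge\dfrac{\log(n\log n)}{\log q}$, writing $u=n/m$, $$\exp\left(-C\,\frac{u\log(u+1)}{m}\right)\le\frac{\mathbb{P}(f_n\text{ is }m\text{-smooth})}{\mathbb{P}(\pi_n\text{ is }m\text{-smooth})}\le\exp\left(C\,\frac{u\log(u+1)}{m}\right).$$
   Context: $\log$ is the natural logarithm. $\pi_n$ is a uniformly random permutation in the symmetric group $S_n$. $f_n=f_{n,q}$ is a uniformly random element of the set of monic polynomials of degree $n$ over the finite field $\mathbb{F}_q$. A permutation is $m$-smooth if all its cycles have length at most $m$. A polynomial over $\mathbb{F}_q$ is $m$-smooth if all its irreducible factors have degree at most $m$. *)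

(* Defs.v *)
From mathcomp Require Import all_boot all_order all_fingroup all_algebra.
From mathcomp Require Import boolp reals.

Set Implicit Arguments.
Unset Strict Implicit.
Unset Printing Implicit Defensive.

Import GRing.Theory.
Local Open Scope ring_scope.

Definition uniform_prob (R : realType) (T : finType) (A : {set T})
    (P : T -> Prop) : R :=
  #|[set x in A | `[< P x >]]|%:R / #|A|%:R.

(* porbits s also contains the fixed points of s, as cycles of length 1. *)
Definition smooth_perm (n m : nat) (s : 'S_n) : Prop :=
  forall c : {set 'I_n}, c \in porbits s -> (#|c| <= m)%N.

Definition smooth_poly (F : fieldType) (m : nat) (f : {poly F}) : Prop :=
  forall g : {poly F}, irreducible_poly g -> g %| f -> ((size g).-1 <= m)%N.

(* {poly_n.+1 F} is the finite type of polynomials of degree at most n. *)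
Definition monic_polys (F : finFieldType) (n : nat) : {set {poly_n.+1 F}} :=
  [set f : {poly_n.+1 F} | ((f : {poly F}) \is monic) && (size f == n.+1)].

Definition prob_smooth_perm (R : realType) (n m : nat) : R :=
  uniform_prob R [set: 'S_n] (fun s => smooth_perm m s).

Definition prob_smooth_poly (R : realType) (F : finFieldType) (n m : nat) : R :=
  uniform_prob R (monic_polys F n) (fun f => smooth_poly m f).

(* Main.v *)
Require Import Defs.
From mathcomp Require Import all_boot all_order all_fingroup all_algebra.
From mathcomp Require Import ring lra zify.
From mathcomp Require Import boolp reals sequences exp.

Set Implicit Arguments.
Unset Strict Implicit.
Unset Printing Implicit Defensive.

Import Order.TTheory GRing.Theory Num.Theory.
Local Open Scope ring_scope.

(** Write [p n] and [a n] for the probabilities that a random permutation of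
    [n] points, respectively a random monic polynomial of degree [n], is
    [m]-smooth.  Marking a point of a permutation, or a prime power dividing a
    polynomial, gives the recurrences
      [n p_n = sum_(1 <= j <= m) p_(n-j)]  and
      [n a_n = sum_(1 <= j <= n) c_j a_(n-j)]
    (terms of negative index being zero), where [c_j = q^(-j) Lambda_m(j)] and [Lambda_m(j)] sums [deg P] over the
    prime powers [P^k] of degree [j] with [deg P <= m].  For [j <= m] this is
    the full von Mangoldt sum, so [c_j = 1]; for [j > m] only proper divisors
    of [j] contribute and [c_j <= 2 q^(min(m, j/2) - j)].  In terms of
    generating functions,
      [A(z) = P(z) exp (sum_(j > m) c_j z^j / j)].

    All [c_j] are nonnegative, so [a_n >= p_n], which is more than the lower
    bound asserts.

    For the upper bound, [p] is log-concave ([cycle_coef_log_concave]).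
    Let [x >= 1] satisfy [x^m = p_(n-m) / p_n].  Log-concavity gives
    [p_(n-k) <= p_n x^k] for [m <= k <= n] and [sum_(1 <= i <= m) x^i <= n]
    ([cycle_coef_saddle]), so [x] plays the part of the saddle point, but all
    inequalities are exact.  The exponential factor above has no terms in
    degrees [1..m], whence ([perturbed_le_expR])
      [a_n / p_n <= exp (sum_(m < j <= n) c_j x^j / j)].

    It remains to bound the exponent ([saddle_tail_bound]).  Put [t = x^m] and
    [V = u ln (u+1)].  Summing the geometric series, [t - 1 <= u ln t], hence
    [t <= 6 V]; the hypothesis on [m] says [q^m >= n ln n], hence
    [m V <= 2 q^m].  The terms with [m < j <= 2 m] add up to
    [O (t q^(-m/2) + t^2 q^(-m))], those with [j > 2 m] to [O (t^2 q^(-m))], and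
    both are [O (V / m)]. *)

(** * Counting permutations with short cycles *)

Section SmoothPermutations.

Variable m : nat.

(** Working with subsets [A] of a fixed type lets points be deleted one at a
    time without changing the type of the permutations. *)
Definition smooth_on (T : finType) (A : {set T}) : {set {perm T}} :=
  [set s | perm_on A s & [forall (z | z \in A), #|porbit s z| <= m]%N].

(** The cycle of [x] has length exactly [k] and escapes the bound [m], so that
    it can be shortened step by step. *)
Definition smooth_off_cycle (T : finType) (A : {set T}) (x : T) (k : nat) :
    {set {perm T}} :=
  [set s | [&& perm_on A s, #|porbit s x| == k &
    [forall (z | (z \in A) && (z \notin porbit s x)), #|porbit s z| <= m]%N]].

Lemma porbit_sub_stable (T : finType) (s : {perm T}) (B : {set T}) x :
  (forall z, z \in B -> s z \in B) -> x \in B -> porbit s x \subset B.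
Proof.
move=> sB xB; apply/subsetP=> _ /porbitP[i ->].
by elim: i => [|i IH]; rewrite ?expg0 ?perm1 // expgSr permM sB.
Qed.

Lemma porbit_stable (T : finType) (s : {perm T}) x z :
  z \in porbit s x -> s z \in porbit s x.
Proof.
by rewrite -!eq_porbit_mem => /eqP <-; have /= := porbit_perm s 1 z; rewrite expg1 => ->.
Qed.

(** Precomposing with the transposition of [x] and a fixed point [y] inserts
    [y] into the cycle of [x], just after [x]. *)
Lemma porbit_tperm (T : finType) (s : {perm T}) (x y : T) :
  s y = y -> x != y ->
  porbit (tperm x y * s) x = y |: porbit s x.
Proof.
move=> sy xy; set t := (tperm x y * s)%g.
have tx : t x = y by rewrite permM tpermL.
have ty : t y = s x by rewrite permM tpermR.
have tz z : z != x -> z != y -> t z = s z.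
  by move=> zx zy; rewrite permM tpermD // eq_sym.
have yNx : y \notin porbit s x.
  apply/negP=> /porbitP[i]; elim: i => [|i IH].
    by rewrite expg0 perm1 => /eqP; rewrite eq_sym (negPf xy).
  by rewrite expgSr permM => E; apply: IH; apply: (@perm_inj _ s); rewrite sy -E.
apply/eqP; rewrite eqEsubset; apply/andP; split.
  apply: porbit_sub_stable; last by rewrite !inE porbit_id orbT.
  move=> z; case: (eqVneq z x) => [->|zx]; first by rewrite tx !inE eqxx.
  case: (eqVneq z y) => [->|zy].
    by rewrite ty !inE porbit_stable ?porbit_id ?orbT.
  by rewrite !inE (negPf zy) tz //= => /porbit_stable ->; rewrite orbT.
have yx : y \in porbit t x by rewrite -tx porbit_stable // porbit_id.
apply/subsetP=> z; rewrite !inE => /predU1P[-> //|].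
apply/subsetP: z; apply: porbit_sub_stable; last exact: porbit_id.
move=> z zt; case: (eqVneq z x) => [->|zx].
  by rewrite -ty porbit_stable.
case: (eqVneq z y) => [->|zy]; first by rewrite sy.
by rewrite -tz // porbit_stable.
Qed.

Lemma porbit_agree (T : finType) (s t : {perm T}) (x : T) z :
  (forall w, w \notin porbit s x -> t w = s w) ->
  z \notin porbit s x -> porbit s z \subset porbit t z ->
  porbit t z = porbit s z.
Proof.
move=> ts zx st; apply/eqP; rewrite eqEsubset st andbT.
apply: porbit_sub_stable; last exact: porbit_id.
move=> w wz; rewrite ts ?porbit_stable //.
apply: contra zx => wx; rewrite -eq_porbit_mem in wx.
by rewrite -(eqP wx) porbit_sym.
Qed.

Lemma porbit_tperm_off (T : finType) (s : {perm T}) (x y z : T) :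
  s y = y -> x != y -> z \notin porbit (tperm x y * s) x ->
  porbit (tperm x y * s) z = porbit s z.
Proof.
move=> sy xy zx; set t := (tperm x y * s)%g in zx *.
have off w : w \notin porbit t x -> s w = t w.
  rewrite porbit_tperm // !inE negb_or => /andP[wy wx].
  by rewrite permM tpermD 1?eq_sym //; apply: contraNneq wx => ->; apply: porbit_id.
symmetry; apply: (porbit_agree (x := x)) => //.
apply: porbit_sub_stable; last exact: porbit_id.
move=> w wz; rewrite -off ?porbit_stable //.
rewrite porbit_tperm // !inE negb_or.
move: zx; rewrite porbit_tperm // !inE negb_or => /andP[zy zx].
apply/andP; split.
  apply: contraNneq zy => wy; subst w.
  have : porbit s y \subset [set y].
    by apply: porbit_sub_stable => [u|]; rewrite !inE // => /eqP ->; rewrite sy.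
  move/subsetP/(_ z); rewrite porbit_sym wz inE; exact.
apply: contra zx => wx.
by move: wz wx; rewrite -!eq_porbit_mem => /eqP -> .
Qed.

Lemma smooth_off_cycle1 (T : finType) (A : {set T}) x :
  x \in A -> smooth_off_cycle A x 1 = smooth_on (A :\ x).
Proof.
move=> xA; apply/setP=> s; rewrite !inE; apply/and3P/andP.
  case=> sA sx1 sm; have ox : porbit s x = [set x].
    by apply/esym/eqP; rewrite eqEcard sub1set porbit_id (eqP sx1) cards1.
  split; last first.
    apply/forall_inP=> z; rewrite !inE => /andP[zx zA].
    by apply: (forall_inP sm); rewrite zA ox inE zx.
  apply/subsetP=> z zs; rewrite !inE (subsetP sA) // andbT.
  apply: contraNneq zs => ->.
  by rewrite -[_ == _]in_set1 -ox porbit_stable ?porbit_id.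
case=> sA sm; have sx : s x = x.
  by apply: out_perm sA _; rewrite !inE eqxx.
have ox : porbit s x = [set x].
  apply/eqP; rewrite eqEsubset sub1set porbit_id andbT.
  by apply: porbit_sub_stable => [z|]; rewrite !inE // => /eqP->; rewrite sx.
split.
- by apply: subset_trans sA (subsetDl _ _).
- by rewrite ox cards1.
apply/forall_inP=> z /andP[zA]; rewrite ox inE => zx.
by apply: (forall_inP sm); rewrite !inE zx.
Qed.

(** Split according to [y = s x].  The involution [s |-> tperm x y * s] takes
    the permutations sending [x] to [y] to those fixing [y]: it removes [y] from
    the cycle of [x] and leaves the other cycles alone. *)
Lemma smooth_off_cycleS (T : finType) (A : {set T}) x k :
  x \in A -> (0 < k)%N ->
  #|smooth_off_cycle A x k.+1| =
  (\sum_(y in A :\ x) #|smooth_off_cycle (A :\ y) x k|)%N.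
Proof.
move=> xA k0; rewrite -sum1_card.
rewrite (partition_big (fun s : {perm T} => s x) (mem (A :\ x))) /=; last first.
  move=> s; rewrite !inE => /and3P[sA sx _]; rewrite (perm_closed _ sA) xA andbT.
  apply: contraTneq sx => sx.
  have -> : porbit s x = [set x].
    apply/eqP; rewrite eqEsubset sub1set porbit_id andbT.
    by apply: porbit_sub_stable => [z|]; rewrite !inE // => /eqP->; rewrite sx.
  by rewrite cards1 eqSS; case: k k0.
apply: eq_bigr => y /[!inE] /andP[yx yA].
have xy : x != y by rewrite eq_sym.
have tinv : involutive (fun s : {perm T} => tperm x y * s)%g.
  by move=> s; rewrite mulgA tperm2 mul1g.
rewrite -sum1_card (reindex_inj (inv_inj tinv)) /=; apply: eq_bigl => s.
rewrite inE permM tpermL; apply/andP/idP.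
  case=> /and3P[sA sx sm] /eqP sy.
  rewrite inE; apply/and3P; split.
  - apply/subsetP=> z; rewrite inE => zs; rewrite !inE.
    have -> /= : z != y by apply: contraNneq zs => ->; rewrite sy.
    case: (eqVneq z x) => [-> //|zx].
    case: (eqVneq z y) => [-> //|zy].
    by apply: (subsetP sA); rewrite inE permM tpermD // eq_sym.
  - move: sx; rewrite porbit_tperm // cardsU1.
    have -> : y \notin porbit s x; last by rewrite add1n eqSS.
    apply: contra yx; rewrite porbit_sym => /porbitP[i ->].
    by elim: i => [|i IH]; rewrite ?expg0 ?perm1 ?expgS ?permM ?sy.
  apply/forall_inP=> z; rewrite !inE => /andP[/andP[zy zA] zx].
  have zNx : z \notin porbit (tperm x y * s) x.
    by rewrite porbit_tperm // !inE (negPf zy).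
  by rewrite -(porbit_tperm_off sy xy zNx); apply: (forall_inP sm); rewrite zA.
rewrite inE => /and3P[sA sx sm].
have sy : s y = y by apply: out_perm sA _; rewrite !inE eqxx.
split; last by rewrite sy.
apply/and3P; split.
- apply/subsetP=> z; rewrite inE => zs.
  case: (eqVneq z x) => [-> //|zx]; case: (eqVneq z y) => [-> //|zy].
  have := subsetP sA z; rewrite !inE zy /=; apply.
  by move: zs; rewrite permM tpermD // eq_sym.
- rewrite porbit_tperm // cardsU1.
  have -> : y \notin porbit s x; last by rewrite add1n eqSS.
  apply: contra yx; rewrite porbit_sym => /porbitP[i ->].
  by elim: i => [|i IH]; rewrite ?expg0 ?perm1 ?expgS ?permM ?sy.
apply/forall_inP=> z /andP[zA zx].
rewrite porbit_tperm_off //; apply: (forall_inP sm).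
by move: zx; rewrite porbit_tperm // !inE negb_or => /andP[-> ->]; rewrite zA.
Qed.

Lemma card_smooth_off_cycle (T : finType) (S : nat -> nat) k (A : {set T}) x a :
  (forall B : {set T}, #|B| <= a -> #|smooth_on B| = S #|B|)%N ->
  x \in A -> #|A| = a.+1 ->
  (#|smooth_off_cycle A x k.+1| = a ^_ k * S (a - k))%N.
Proof.
elim: k A a => [|k IH] A a HS xA cA.
  rewrite smooth_off_cycle1 // ffactn0 mul1n subn0 HS; last first.
    by move: cA; rewrite (cardsD1 x) xA add1n => -[->].
  by move: cA; rewrite (cardsD1 x) xA add1n => -[->].
rewrite smooth_off_cycleS //.
have cAx : #|A :\ x| = a by move: cA; rewrite (cardsD1 x) xA add1n => -[->].
case: a => [|a] in HS cA cAx *.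
  by rewrite (cards0_eq cAx) big_set0 ffact0n.
rewrite (eq_bigr (fun=> a ^_ k * S (a - k)))%N; last first.
  move=> y; rewrite !inE => /andP[yx yA]; apply: IH.
  - by move=> B Ba; apply: HS; apply: leq_trans Ba _.
  - by rewrite !inE eq_sym yx.
  - by move: cA; rewrite (cardsD1 y) yA add1n => -[->].
by rewrite sum_nat_const cAx ffactSS mulnA subSS.
Qed.

Lemma smooth_on_partition (T : finType) (A : {set T}) x :
  x \in A -> (#|smooth_on A| = \sum_(k < m) #|smooth_off_cycle A x k.+1|)%N.
Proof.
move=> xA; rewrite -[LHS]sum1_card.
have -> : (\sum_(k < m) #|smooth_off_cycle A x k.+1| =
    \sum_(k < m) \sum_(s in smooth_off_cycle A x k.+1) 1)%N.
  by apply: eq_bigr => k _; rewrite sum1_card.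
rewrite (exchange_big_dep (mem (smooth_on A))) /=; last first.
  move=> k s _; rewrite !inE => /and3P[-> /eqP sx sm].
  apply/forall_inP=> z zA; case: (boolP (z \in porbit s x)) => [|zx].
    by rewrite -eq_porbit_mem => /eqP ->; rewrite sx.
  by apply: (forall_inP sm); rewrite zA.
apply: eq_bigr => s; rewrite inE => /andP[sA /forall_inP sm].
have ox : (#|porbit s x|.-1 < m)%N.
  by rewrite prednK ?sm // lt0n card_porbit_neq0.
rewrite (big_pred1 (Ordinal ox)) // => k; rewrite inE sA /= -val_eqE /=.
have -> : [forall (z | (z \in A) && (z \notin porbit s x)), #|porbit s z| <= m]%N.
  by apply/forall_inP=> z /andP[zA _]; exact: sm.
by rewrite andbT; case: #|_| (card_porbit_neq0 s x) => //= c _; rewrite eqSS eq_sym.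
Qed.

(** The recurrence determines the counts, so they depend only on the
    cardinality; this dispenses with transport along a bijection. *)
Lemma card_smooth_on (T T' : finType) (A : {set T}) (B : {set T'}) :
  #|A| = #|B| -> #|smooth_on A| = #|smooth_on B|.
Proof.
have [n] := ubnP #|A|; elim: n => // n IH in T T' A B *.
rewrite ltnS => An AB; case cA: #|A| => [|a].
  rewrite (cards0_eq cA) (cards0_eq (etrans (esym AB) cA)).
  have e (U : finType) : smooth_on (set0 : {set U}) = [set 1%g].
    apply/setP=> s; rewrite !inE; apply/andP/eqP => [[s0 _]|->].
      by apply/permP=> z; rewrite perm1 (out_perm s0) // inE.
    by split; [exact: perm_on1 | apply/forall_inP => z; rewrite inE].
  by rewrite !e !cards1.
have [x xA] : exists x, x \in A by apply/card_gt0P; rewrite cA.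
have [y yB] : exists y, y \in B by apply/card_gt0P; rewrite -AB cA.
rewrite (smooth_on_partition xA) (smooth_on_partition yB).
pose S j := #|smooth_on [set: 'I_j]|.
have HS (U : finType) (C : {set U}) : (#|C| <= a)%N -> #|smooth_on C| = S #|C|.
  move=> Ca; apply: IH; last by rewrite cardsT card_ord.
  by move: An; rewrite cA; apply: leq_ltn_trans.
apply: eq_bigr => k _.
rewrite (@card_smooth_off_cycle _ S _ _ _ a) //; last exact: HS.
rewrite (@card_smooth_off_cycle _ S _ _ _ a) -?AB //; exact: HS.
Qed.

Definition num_smooth_perm (n : nat) : nat := #|smooth_on [set: 'I_n]|.

(** Classify by the length of the cycle through one marked point. *)
Lemma num_smooth_perm_rec n :
  (num_smooth_perm n.+1 = \sum_(k < m) n ^_ k * num_smooth_perm (n - k))%N.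
Proof.
rewrite /num_smooth_perm (smooth_on_partition (in_setT ord0)).
apply: eq_bigr => k _.
apply: (@card_smooth_off_cycle _ num_smooth_perm); rewrite ?inE ?cardsT ?card_ord //.
by move=> B _; apply: card_smooth_on; rewrite cardsT card_ord.
Qed.

Lemma num_smooth_perm0 : num_smooth_perm 0 = 1%N.
Proof.
rewrite /num_smooth_perm -(cards1 (1%g : 'S_0)); apply: eq_card => s.
rewrite !inE; have -> : s = 1%g by apply/permP=> -[].
by rewrite eqxx perm_on1; apply/forall_inP => -[].
Qed.

End SmoothPermutations.

Section PermProbability.

Variable R : realType.

Lemma prob_smooth_permE (n m : nat) :
  prob_smooth_perm R n m = (num_smooth_perm m n)%:R / n`!%:R.
Proof.
rewrite /prob_smooth_perm /uniform_prob cardsT card_Sn; congr (_%:R / _).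
apply: eq_card => s; rewrite !inE; apply/asboolP/andP => [sm|[_ sm]].
  split; first by apply/subsetP=> z; rewrite !inE.
  by apply/forall_inP=> z _; apply: sm; apply: imset_f.
by move=> c /imsetP[z _ ->]; apply: (forall_inP sm).
Qed.

Lemma prob_smooth_perm0 (m : nat) : prob_smooth_perm R 0 m = 1.
Proof. by rewrite prob_smooth_permE num_smooth_perm0 divr1. Qed.

Lemma prob_smooth_perm_rec (m n : nat) :
  n.+1%:R * prob_smooth_perm R n.+1 m =
  \sum_(k < m | (k <= n)%N) prob_smooth_perm R (n - k) m.
Proof.
rewrite prob_smooth_permE num_smooth_perm_rec factS natrM.
rewrite (bigID (fun k : 'I_m => (k <= n)%N)) /= [X in (_ + X)%N]big1 ?addn0; last first.
  by move=> k; rewrite -ltnNge => nk; rewrite ffact_small.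
have f0 j : j`!%:R != 0 :> R by rewrite pnatr_eq0 -lt0n fact_gt0.
rewrite invfM mulrCA mulVKf ?pnatr_eq0 // natr_sum mulr_suml.
apply: eq_bigr => k kn; rewrite prob_smooth_permE.
have := f0 n; rewrite -(ffact_fact kn) !natrM mulf_eq0 negb_or => /andP[a _].
by rewrite -mulf_div divff // mul1r.
Qed.

End PermProbability.
(** * Counting smooth polynomials *)

Section SmoothPolynomials.

Variable F : finFieldType.
Let q := #|F|.

(** The finite types [{poly_n.+1 F}] vary with the degree, which is awkward for
    products; sequences over the one type [{poly F}] are not. *)
Definition monics (n : nat) : seq {poly F} :=
  [seq polyn f | f <- enum (monic_polys F n)].

Lemma mem_monics n (f : {poly F}) :
  (f \in monics n) = (f \is monic) && (size f == n.+1).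
Proof.
apply/mapP/andP => [[g]|[fm fs]].
  by rewrite mem_enum inE => /andP[gm gs] ->.
have fn : (size f <= n.+1)%N by rewrite (eqP fs).
by exists (NPoly fn) => //; rewrite mem_enum inE fm.
Qed.

Lemma monics_uniq n : uniq (monics n).
Proof. by rewrite map_inj_uniq ?enum_uniq //; exact: val_inj. Qed.

Lemma card_monic_polys n : #|monic_polys F n| = (q ^ n)%N.
Proof.
rewrite -(card_npoly F n).
have sz (g : {poly_n F}) : size ('X^n + (g : {poly F})) = n.+1.
  by rewrite size_polyDl size_polyXn // ltnS size_npoly.
pose h (g : {poly_n F}) : {poly_n.+1 F} := npolyp n.+1 ('X^n + (g : {poly F})).
have hE g : h g = 'X^n + (g : {poly F}) :> {poly F} by rewrite npolypK // sz.
have hinj : injective h.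
  move=> g g' /(congr1 (fun p : {poly_n.+1 F} => (p : {poly F}))).
  by rewrite !hE => /addrI/val_inj.
rewrite -(card_imset predT hinj); apply: eq_card => f.
rewrite inE; apply/andP/imsetP => [[fm fs]|[g _ ->]]; last first.
  rewrite hE sz eqxx; split=> //; rewrite monicE lead_coefDl ?lead_coefXn //.
  by rewrite size_polyXn ltnS size_npoly.
have gs : (size ((f : {poly F}) - 'X^n)%R <= n)%N.
  apply/leq_sizeP => j nj; rewrite coefB coefXn.
  move: nj; rewrite leq_eqVlt => /predU1P[<-|nj].
    rewrite eqxx; move: fm; rewrite monicE lead_coefE (eqP fs) /= => /eqP ->.
    by rewrite subrr.
  by rewrite nth_default ?(eqP fs) // gtn_eqF // subrr.
by exists (NPoly gs) => //; apply: val_inj; rewrite /= -/(h _) hE /= addrC subrK.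
Qed.

Lemma size_monics n : size (monics n) = (q ^ n)%N.
Proof. by rewrite size_map -cardE card_monic_polys. Qed.

Lemma size_monic_exp (P : {poly F}) k :
  P \is monic -> size (P ^+ k) = ((size P).-1 * k).+1.
Proof.
move=> Pm; rewrite -size_exp prednK // size_poly_gt0.
exact/monic_neq0/monic_exp.
Qed.

Definition smoothb (m : nat) (f : {poly F}) : bool := `[< smooth_poly m f >].

Definition num_smooth_poly (m n : nat) : nat := count (smoothb m) (monics n).

Definition irreds (d : nat) : seq {poly F} :=
  [seq P <- monics d | irreducibleb P].

Lemma mem_irreds d P : reflect
  [/\ P \is monic, size P = d.+1 & irreducible_poly P] (P \in irreds d).
Proof.
rewrite mem_filter mem_monics; apply: (iffP and3P).
  by case=> /irreducibleP Pi Pm /eqP Ps.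
by case=> Pm Ps /irreducibleP Pi; rewrite Ps eqxx.
Qed.

Lemma irreds_uniq d : uniq (irreds d).
Proof. by rewrite filter_uniq // monics_uniq. Qed.

Lemma irreducible_divisor (f : {poly F}) : (1 < size f)%N ->
  exists2 P : {poly F}, P \is monic /\ irreducible_poly P & P %| f.
Proof.
have [n] := ubnP (size f); elim: n f => // n IH f; rewrite ltnS => fn f1.
have f0 : f != 0 by rewrite -size_poly_gt0 ltnW.
case: (pselect (irreducible_poly f)) => [fi|fNi].
  have lf : (lead_coef f)^-1 != 0 by rewrite invr_eq0 lead_coef_eq0.
  exists ((lead_coef f)^-1 *: f); last by rewrite dvdpZl // dvdpp.
  split; first by rewrite monicE lead_coefZ mulVf // lead_coef_eq0.
  split; first by rewrite size_scale.
  move=> g g1; rewrite dvdpZr // => gf; apply: eqp_trans (fi.2 _ g1 gf) _.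
  by rewrite eqp_sym eqp_scale.
have [g [g1 gf gNf]] : exists g : {poly F}, [/\ size g != 1%N, g %| f & ~~ (g %= f)].
  apply: contrapT => H; apply: fNi; split=> // g g1 gf.
  by apply: contrapT => /negP gNf; apply: H; exists g.
have g0 : g != 0 by apply: contraNneq f0 => g0; rewrite g0 dvd0p in gf.
have sg : (size g < size f)%N.
  rewrite ltn_neqAle dvdp_leq // andbT; apply: contra gNf.
  by rewrite dvdp_size_eqp.
have [||P PP Pg] := IH g.
- exact: leq_trans sg fn.
- by rewrite ltn_neqAle eq_sym g1 size_poly_gt0.
by exists P => //; apply: dvdp_trans Pg gf.
Qed.

Lemma irreducible_dvd_eq (P Q : {poly F}) : P \is monic -> Q \is monic ->
  irreducible_poly P -> irreducible_poly Q -> P %| Q -> P = Q.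
Proof.
move=> Pm Qm Pi Qi PQ; apply/eqP; rewrite -eqp_monic //; apply: Qi.2 => //.
by rewrite neq_ltn Pi.1 orbT.
Qed.

Lemma dvdp_expn_prime (P Q g : {poly F}) k :
  P \is monic -> irreducible_poly P -> Q \is monic -> irreducible_poly Q ->
  (P ^+ k.+1 %| Q * g) = if P == Q then P ^+ k %| g else P ^+ k.+1 %| g.
Proof.
move=> Pm Pi Qm Qi; case: eqP => [<-|PQ].
  by rewrite exprS dvdp_mul2l // irredp_neq0.
rewrite Gauss_dvdpr // coprimep_expl // irreducible_poly_coprime //.
by apply/negP=> /(irreducible_dvd_eq Pm Qm Pi Qi).
Qed.

Lemma sum_indicator_irreds N d (Q : {poly F}) :
  Q \in irreds d -> (0 < d <= N)%N ->
  (\sum_(1 <= e < N.+1) \sum_(P <- irreds e) e * (P == Q) = d)%N.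
Proof.
move=> Qd /andP[d0 dN].
transitivity (\sum_(1 <= e < N.+1) e * (e == d))%N.
  apply: eq_bigr => e _; rewrite -big_distrr /=; congr (_ * _)%N.
  rewrite -big_mkcond /= sum1_count (count_uniq_mem _ (irreds_uniq e)).
  congr (nat_of_bool _); case/mem_irreds: Qd => Qm Qs Qi.
  by apply/mem_irreds/eqP => [[_]|->]; [rewrite Qs => -[]|].
rewrite (bigD1_seq d) ?mem_index_iota ?iota_uniq ?d0 ?ltnS ?dN //= eqxx muln1.
by rewrite big1 ?addn0 // => e /negPf ->; rewrite muln0.
Qed.

(** Unique factorisation in additive form: the multiplicity of [P] in [f] is the
    number of [k >= 1] with [P ^+ k %| f].  Dividing [f] by one irreducible
    factor [Q] lowers the multiplicity of [Q] by one and no other. *)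
Lemma sum_degree_prime_powers N n (f : {poly F}) : f \in monics n -> (n <= N)%N ->
  (\sum_(1 <= d < N.+1) \sum_(P <- irreds d) \sum_(1 <= k < N.+1)
     d * (P ^+ k %| f)%R = n)%N.
Proof.
have [b] := ubnP n; elim: b n f => // b IH n f; rewrite ltnS => nb.
rewrite mem_monics => /andP[fm /eqP fs] nN.
have [n0|n0] := posnP n.
  rewrite big1_seq // => d /andP[_]; rewrite mem_index_iota => /andP[d0 _].
  rewrite big1_seq // => P /andP[_ /mem_irreds[Pm Ps _]].
  rewrite big1_seq // => k /andP[_]; rewrite mem_index_iota => /andP[k0 _].
  have -> : (P ^+ k %| f)%R = false; last by rewrite muln0.
  apply/negP=> /dvdp_leq; rewrite -size_poly_gt0 fs n0 => /(_ isT).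
  by rewrite size_monic_exp // Ps /= ltnS leqn0 muln_eq0 !eqn0Ngt d0 k0.
have [Q [Qm Qi] /dvdpP[g fE]] : exists2 Q : {poly F},
    Q \is monic /\ irreducible_poly Q & Q %| f.
  by apply: irreducible_divisor; rewrite fs.
rewrite mulrC in fE.
have gm : g \is monic by move: fm; rewrite fE monicMl.
pose d := (size Q).-1.
have Qs : size Q = d.+1 by rewrite prednK // ltnW // Qi.1.
have d0 : (0 < d)%N by move: Qi.1; rewrite Qs.
have gs : size g = (n - d).+1.
  move: fs; rewrite fE size_monicM // ?monic_neq0 // Qs.
  have : (0 < size g)%N by rewrite size_poly_gt0 monic_neq0.
  by case: (size g) => [|s] // _; lia.
have dn : (d <= n)%N.
  have := dvdp_leq (monic_neq0 fm) (_ : Q %| f); rewrite fs Qs ltnS; apply.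
  by rewrite fE dvdp_mulr.
have gM : g \in monics (n - d) by rewrite mem_monics gm gs eqxx.
have vE P e : P \in irreds e -> (\sum_(1 <= k < N.+1) e * (P ^+ k %| f)%R =
    e * (P == Q) + \sum_(1 <= k < N.+1) e * (P ^+ k %| g)%R)%N.
  case/mem_irreds=> Pm Ps Pi.
  rewrite -!big_distrr -mulnDr; congr (_ * _)%N.
  rewrite !big_add1 /=.
  have vk k : (P ^+ k.+1 %| f) = if P == Q then P ^+ k %| g else P ^+ k.+1 %| g.
    by rewrite fE dvdp_expn_prime.
  rewrite (eq_bigr _ (fun k _ => congr1 nat_of_bool (vk k))).
  case: eqP => [PQ|_] //.
  have N0 : (0 < N)%N by lia.
  rewrite -{1}(prednK N0) big_nat_recl // -[in RHS](prednK N0) big_nat_recr //=.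
  rewrite dvd1p prednK //; have -> : (P ^+ N %| g)%R = false by
    apply/negP=> /(dvdp_leq (monic_neq0 gm)); rewrite size_monic_exp // PQ Qs gs /=; nia.
  by rewrite addn0.
transitivity (\sum_(1 <= e < N.+1) \sum_(P <- irreds e) (e * (P == Q) +
    \sum_(1 <= k < N.+1) e * (P ^+ k %| g)%R))%N.
  by apply: eq_bigr => e _; apply: eq_big_seq => P /vE.
under eq_bigr => e _ do rewrite big_split /=.
rewrite big_split /= (@sum_indicator_irreds N d) ?d0 ?(leq_trans dn) //; last first.
  by apply/mem_irreds.
rewrite (IH (n - d)%N) //; lia.
Qed.

Lemma smoothb_mul_exp m d k (P g : {poly F}) :
  P \in irreds d -> (d <= m)%N -> smoothb m (P ^+ k * g) = smoothb m g.
Proof.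
case/mem_irreds=> Pm Ps Pi dm; apply/asboolP/asboolP => sm h hi hd.
  by apply: sm => //; apply: dvdp_mull.
case: (boolP (h %| P)) => [hP|hP].
  by apply: leq_trans dm; have := dvdp_leq (monic_neq0 Pm) hP; rewrite Ps; case: size.
apply: sm => //; move: hd; rewrite Gauss_dvdpr // coprimep_expr //.
by rewrite irreducible_poly_coprime.
Qed.

Lemma count_smooth_multiples m n d k (P : {poly F}) :
  P \in irreds d -> (d <= m)%N -> (d * k <= n)%N ->
  count (fun f => smoothb m f && (P ^+ k %| f)%R) (monics n) =
  num_smooth_poly m (n - d * k).
Proof.
move=> Pd dm dkn; have [Pm Ps Pi] := mem_irreds _ _ Pd.
have Pk0 : P ^+ k != 0 by rewrite expf_neq0 // monic_neq0.
rewrite /num_smooth_poly -!size_filter -[RHS](size_map (fun g => P ^+ k * g)).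
apply: perm_size; apply: uniq_perm.
- by rewrite filter_uniq // monics_uniq.
- rewrite map_inj_uniq ?filter_uniq ?monics_uniq //; exact: mulfI.
have sPk g : g != 0 -> size (P ^+ k * g) = (d * k + size g)%N.
  by move=> g0; rewrite size_mul // size_monic_exp // Ps addSn.
move=> f; rewrite mem_filter mem_monics; apply/idP/mapP.
  case/and3P=> /andP[fsm /dvdpP[g]]; rewrite mulrC => fE fm /eqP fs; exists g => //.
  have gm : g \is monic by move: fm; rewrite fE monicMl // monic_exp.
  move: fsm fs; rewrite fE (smoothb_mul_exp _ _ Pd dm) sPk ?monic_neq0 // => gsm gs.
  by rewrite mem_filter gsm mem_monics gm /= -subSn // -gs addKn.
case=> g; rewrite mem_filter mem_monics => /and3P[gsm gm /eqP gs] ->.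
rewrite (smoothb_mul_exp _ _ Pd dm) gsm dvdp_mulr ?dvdpp //= sPk ?monic_neq0 //.
by rewrite monicMl ?monic_exp // gm gs addnS subnKC //=.
Qed.

Lemma count_smooth_multiples0 m n d k (P : {poly F}) :
  P \in irreds d -> (0 < k)%N -> ((m < d) || (n < d * k))%N ->
  count (fun f => smoothb m f && (P ^+ k %| f)) (monics n) = 0%N.
Proof.
case/mem_irreds=> Pm Ps Pi k0 big; apply/eqP; rewrite -leqn0 leqNgt -has_count.
apply/hasPn=> f; rewrite mem_monics => /andP[fm /eqP fs]; apply/negP.
case/andP=> /asboolP fsm Pkf; case/orP: big => [md|ndk].
  have Pf : P %| f.
    by apply: dvdp_trans Pkf; case: k k0 => // k _; rewrite exprS dvdp_mulr.
  by have := fsm P Pi Pf; rewrite Ps /= leqNgt md.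
have := dvdp_leq (monic_neq0 fm) Pkf; rewrite size_monic_exp // Ps fs /=; lia.
Qed.

Lemma sum_multiples n d (G : nat -> nat) : (0 < d)%N ->
  (\sum_(1 <= k < n.+1 | d * k <= n) G (d * k)%N =
   \sum_(1 <= j < n.+1 | d %| j) G j)%N.
Proof.
move=> d0; transitivity (\sum_(1 <= k < n.+1) \sum_(1 <= j < n.+1 | j == d * k) G j)%N.
  rewrite big_mkcond; apply: eq_big_nat => k /andP[k0 kn].
  case: ifP => [dkn|/negP dkn].
    rewrite -big_filter (_ : [seq j <- _ | _] = [:: (d * k)%N]) ?big_seq1 //.
    rewrite (@eq_filter _ _ (pred1 (d * k)%N)) // filter_pred1_uniq ?iota_uniq //.
    by rewrite mem_index_iota muln_gt0 d0 k0.
  rewrite big1_seq // => j /andP[/eqP ->]; rewrite mem_index_iota ltnS => /andP[_] //.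
rewrite (exchange_big_dep_nat predT) //= [RHS]big_mkcond.
apply: eq_big_nat => j /andP[j0 jn]; case: ifP => [/dvdnP[k jE]|/negP ndj]; last first.
  by rewrite big1_seq // => k /andP[/eqP jE _]; case: ndj; rewrite jE dvdn_mulr.
rewrite -big_filter (_ : [seq k <- _ | _] = [:: k]) ?big_seq1 //.
rewrite (@eq_filter _ _ (pred1 k)) ?filter_pred1_uniq ?iota_uniq //.
  by rewrite mem_index_iota; nia.
by move=> i /=; rewrite jE mulnC eqn_pmul2l // eq_sym.
Qed.

(** The von Mangoldt function of the factor base: the sum of [deg P] over the
    prime powers [P ^+ k] of degree [j] whose base has degree at most [m]. *)
Definition mangoldt (m j : nat) : nat :=
  (\sum_(1 <= d < j.+1 | (d <= m) && (d %| j)) d * size (irreds d))%N.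

(** Sum the degrees of all smooth polynomials, splitting each degree by
    [sum_degree_prime_powers].  The smooth polynomials divisible by [P ^+ k] are
    the [P ^+ k * g] with [g] smooth. *)
Lemma num_smooth_poly_rec m n :
  (n * num_smooth_poly m n =
   \sum_(1 <= j < n.+1) mangoldt m j * num_smooth_poly m (n - j))%N.
Proof.
transitivity (\sum_(f <- monics n | smoothb m f) \sum_(1 <= d < n.+1)
    \sum_(P <- irreds d) \sum_(1 <= k < n.+1) d * (P ^+ k %| f)%R)%N.
  rewrite big_seq_cond (eq_bigr (fun=> n)) => [|f /andP[fn _]]; last first.
    by rewrite (sum_degree_prime_powers fn).
  by rewrite -big_seq_cond big_const_seq iter_addn_0.
rewrite exchange_big /=.
transitivity (\sum_(1 <= d < n.+1) \sum_(1 <= k < n.+1)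
   if (d <= m)%N && (d * k <= n)%N then
     d * size (irreds d) * num_smooth_poly m (n - d * k) else 0)%N.
  apply: eq_big_nat => d /andP[d0 dn].
  rewrite exchange_big /=.
  under eq_bigr => P _ do rewrite exchange_big /=.
  rewrite exchange_big /=; apply: eq_big_nat => k /andP[k0 kn].
  transitivity (\sum_(P <- irreds d)
     d * count (fun f => smoothb m f && (P ^+ k %| f)%R) (monics n))%N.
    by apply: eq_bigr => P _; rewrite -big_distrr /= -big_mkcondr sum1_count.
  case: ifP => [/andP[dm dkn]|/negbT]; last first.
    rewrite negb_and -!ltnNge => H; apply: big1_seq => P /andP[_ Pd].
    by rewrite (count_smooth_multiples0 Pd) // muln0.
  rewrite (eq_big_seq (fun=> d * num_smooth_poly m (n - d * k)))%N; last first.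
    by move=> P Pd; rewrite (count_smooth_multiples Pd).
  by rewrite big_const_seq count_predT iter_addn_0 mulnAC.
transitivity (\sum_(1 <= d < n.+1) \sum_(1 <= j < n.+1 | (d <= m) && (d %| j))
    d * size (irreds d) * num_smooth_poly m (n - j))%N.
  apply: eq_big_nat => d /andP[d0 dn]; case: (d <= m)%N => /=; last first.
    by rewrite big1 ?big_pred0_eq.
  rewrite -big_mkcond /= -big_distrr /=.
  by rewrite (sum_multiples n (fun j => num_smooth_poly m (n - j)) d0) big_distrr.
rewrite (exchange_big_dep_nat predT) //=; apply: eq_big_nat => j /andP[j0 jn].
rewrite big_distrl /= [RHS](big_nat_widen _ _ n.+1) //.
apply: congr_big_nat => // d _; rewrite ltnS -andbA; congr (_ && _).
by case: (boolP (d %| j)%N) => // /(dvdn_leq j0) ->.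
Qed.

Lemma num_smooth_poly_full m n : (n <= m)%N -> num_smooth_poly m n = (q ^ n)%N.
Proof.
move=> nm; rewrite -size_monics; apply/eqP; rewrite -all_count; apply/allP=> f.
rewrite mem_monics => /andP[fm /eqP fs]; apply/asboolP => g gi.
move=> /(dvdp_leq (monic_neq0 fm)); rewrite fs => gf.
by apply: leq_trans nm; case: (size g) gf.
Qed.

(** Every polynomial of degree [n] is [n]-smooth, so the recurrence determines
    the full von Mangoldt sums from the number [q ^ n] of monic polynomials. *)
Lemma mangoldt_full j : (0 < j)%N -> mangoldt j j = (q ^ j)%N.
Proof.
have [b] := ubnP j; elim: b j => // b IH j; rewrite ltnS => jb j0.
have := num_smooth_poly_rec j j; rewrite big_nat_recr // subnn !num_smooth_poly_full // expn0 muln1.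
rewrite (eq_big_nat _ _ (F2 := fun=> (q ^ j)%N)); last first.
  move=> i /andP[i0 ij]; rewrite (_ : mangoldt j i = mangoldt i i); last first.
    apply: congr_big_nat => // d /andP[d0]; rewrite ltnS => di.
    by rewrite di (leq_trans di (ltnW ij)).
  rewrite IH ?(leq_trans ij) // num_smooth_poly_full ?leq_subr // -expnD subnKC //; exact: ltnW.
rewrite sum_nat_const_nat; case: j j0 {jb IH} => // j _.
by rewrite subn1 /= mulSn addnC => /addnI.
Qed.

Lemma mangoldt_small m j : (0 < j <= m)%N -> mangoldt m j = (q ^ j)%N.
Proof.
case/andP=> j0 jm; rewrite -mangoldt_full //; apply: congr_big_nat => // d.
by case/andP=> d0; rewrite ltnS => dj; rewrite dj (leq_trans dj).
Qed.

Lemma card_irreds_le d : (d * size (irreds d) <= q ^ d)%N.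
Proof.
case: d => [|d]; rewrite ?mul0n // -mangoldt_full // /mangoldt.
by rewrite big_mkcond big_nat_recr //= leqnn dvdnn leq_addl.
Qed.

Lemma mangoldt_le m j : (0 < j)%N -> (mangoldt m j <= q ^ j)%N.
Proof.
move=> j0; rewrite -mangoldt_full // /mangoldt [leqLHS]big_mkcond [leqRHS]big_mkcond.
rewrite big_nat_cond [leqRHS]big_nat_cond; apply: leq_sum => d.
rewrite andbT ltnS => /andP[_ ->] /=.
by case: (d <= m)%N => //=; case: ifP.
Qed.

Lemma sum_expn_le k : (1 < q)%N -> (\sum_(1 <= d < k.+1) q ^ d <= 2 * q ^ k)%N.
Proof.
move=> q1; elim: k => [|k IH]; first by rewrite big_geq.
rewrite big_nat_recr //= mul2n -addnn leq_add2r (leq_trans IH) //.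
by rewrite expnS leq_mul2r q1 orbT.
Qed.

(** Beyond the factor base only proper divisors of [j] contribute, and these are
    at most [j./2]; the last term dominates the resulting geometric sum. *)
Lemma mangoldt_large m j : (1 < q)%N -> (m < j)%N ->
  (mangoldt m j <= 2 * q ^ minn m j./2)%N.
Proof.
move=> q1 mj; set k := minn m j./2; apply: leq_trans (sum_expn_le k q1).
have kj : (k < j.+1)%N by rewrite /k; lia.
rewrite /mangoldt [leqRHS](big_nat_widen _ _ j.+1) //.
rewrite big_mkcond [leqRHS]big_mkcond; apply: leq_sum => d _.
case: ifP => // /andP[dm /dvdnP[e jE]].
have e1 : (1 < e)%N.
  by case: e jE mj => [|[|e]] // ->; rewrite ?mul0n // mul1n ltnNge dm.
have -> : (true && (d < k.+1))%N.
  by rewrite ltnS leq_min dm geq_half_double jE -mul2n leq_mul2r e1 orbT.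
exact: card_irreds_le.
Qed.

End SmoothPolynomials.
(** * Log-concavity and the saddle point *)

Section CycleIndexSequence.

Variables (R : realType) (m : nat) (p : nat -> R).
Hypothesis m_gt0 : (0 < m)%N.
Hypothesis p0 : p 0 = 1.
Hypothesis p_rec : forall n,
  n.+1%:R * p n.+1 = \sum_(k < m | (k <= n)%N) p (n - k).

Lemma cycle_coef_gt0 n : 0 < p n.
Proof.
elim/ltn_ind: n => -[|n] IH; first by rewrite p0.
rewrite -(pmulr_rgt0 _ (ltr0Sn R n)) p_rec (bigD1 (Ordinal m_gt0)) //= subn0.
rewrite ltr_pwDl ?IH // sumr_ge0 // => k _; apply/ltW/IH; lia.
Qed.

Lemma cycle_coef_window n : (m <= n)%N -> n%:R * p n = \sum_(k < m) p (n - k.+1).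
Proof.
case: n => [|n]; first by rewrite leqNgt m_gt0.
move=> mn; rewrite p_rec; apply: eq_bigl => k.
by rewrite -ltnS (leq_trans (ltn_ord k)).
Qed.

Lemma cycle_coef_eq1 n : (n <= m)%N -> p n = 1.
Proof.
elim/ltn_ind: n => -[//|n] IH nm.
apply: (mulfI (lt0r_neq0 (ltr0Sn R n))); rewrite p_rec mulr1.
rewrite (eq_bigr (fun=> 1)); last by move=> k kn; apply: IH; lia.
by rewrite -(big_ord_widen m (fun=> 1) nm) sumr_const card_ord.
Qed.

Lemma cycle_coef_diff n : (m <= n)%N -> n.+1%:R * (p n - p n.+1) = p (n - m).
Proof.
move=> mn; rewrite mulrBr p_rec.
rewrite (eq_bigl predT) /=; last first.
  by move=> k; rewrite (leq_trans (ltnW (ltn_ord k))).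
rewrite -natr1 mulrDl mul1r cycle_coef_window //.
have tel : \sum_(k < m) p (n - k.+1) - \sum_(k < m) p (n - k) = p (n - m) - p n.
  rewrite -sumrB -(big_mkord xpredT (fun k => p (n - k.+1) - p (n - k))).
  by rewrite (telescope_sumr (fun k => p (n - k)%N)) // subn0.
by rewrite addrAC tel subrK.
Qed.

Lemma cycle_coef_noninc n : p n.+1 <= p n.
Proof.
have [mn|nm] := leqP m n; last by rewrite !cycle_coef_eq1 // ltnW.
by rewrite -subr_ge0 -(pmulr_rge0 _ (ltr0Sn R n)) cycle_coef_diff // ltW ?cycle_coef_gt0.
Qed.

Lemma cycle_coef_noninc_le i j : (i <= j)%N -> p j <= p i.
Proof.
elim: j => [|j IH]; first by rewrite leqn0 => /eqP ->.
rewrite leq_eqVlt => /predU1P[-> //|ij].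
exact: le_trans (cycle_coef_noninc _) (IH ij).
Qed.

Lemma log_concave_shift N i j :
  (forall k, (k.+2 <= N)%N -> p k * p k.+2 <= p k.+1 ^+ 2) ->
  (i <= j)%N -> (j.+1 <= N)%N -> p i * p j.+1 <= p i.+1 * p j.
Proof.
move=> LC; elim: j => [|j IH]; first by rewrite leqn0 => /eqP -> _; rewrite mulrC.
rewrite leq_eqVlt => /predU1P[-> _|ij jN]; first by rewrite mulrC.
rewrite -(ler_pM2l (cycle_coef_gt0 j)).
have h1 := LC j jN; have h2 := IH ij (ltnW jN).
have := cycle_coef_gt0 i; have := cycle_coef_gt0 j.+1; nra.
Qed.

(** The coefficients of [exp (sum_(j <= m) z^j / j)] are log-concave, a case of
    the Bender-Canfield theorem.  Both sides of the difference
    [n p_n p_(n-m) - (n+1) p_(n+1) p_(n-m-1)], a positive multiple of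
    [p_n ^ 2 - p_(n-1) p_(n+1)], are sums over a window of length [m] by the
    recurrence; they compare term by term by log-concavity at smaller indices. *)
Lemma cycle_coef_log_concave n : p n * p n.+2 <= p n.+1 ^+ 2.
Proof.
elim/ltn_ind: n => n IH.
have [nm|mn] := ltnP n m.
  rewrite (cycle_coef_eq1 (ltnW nm)) (cycle_coef_eq1 nm) mul1r expr1n.
  by rewrite -(cycle_coef_eq1 nm) cycle_coef_noninc.
have LC k : (k.+2 <= n.+1)%N -> p k * p k.+2 <= p k.+1 ^+ 2.
  by move=> kn; apply: IH.
have d1 := cycle_coef_diff mn; have d2 := cycle_coef_diff (leqW mn).
have w1 := cycle_coef_window (leqW mn); have w2 := cycle_coef_window (leqW (leqW mn)).
have key : n.+2%:R * p n.+2 * p (n - m) <= n.+1%:R * p n.+1 * p (n.+1 - m).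
  rewrite w1 w2 !mulr_suml; apply: ler_sum => k _.
  have km := ltn_ord k.
  have -> : (n.+2 - k.+1 = (n - k).+1)%N by lia.
  have -> : (n.+1 - k.+1 = n - k)%N by lia.
  have -> : (n.+1 - m = (n - m).+1)%N by lia.
  by rewrite mulrC [leRHS]mulrC; apply: (log_concave_shift LC); lia.
rewrite -d1 -d2 in key.
have a1 : 0 < n.+1%:R :> R by rewrite ltr0n.
have a2 : 0 < n.+2%:R :> R by rewrite ltr0n.
rewrite -(ler_pM2l (mulr_gt0 a1 a2)); nra.
Qed.

(** To be applied to [G i = ln (p (n - i) / p n)], which is concave by
    log-concavity.  Comparing the chord slope [G k / k] with the one at [m], for
    [k] on either side of [m], gives the two inequalities on [x] below. *)
Lemma concave_chord (n : nat) (G : nat -> R) : G 0 = 0 ->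
  (forall i, (i.+2 <= n)%N -> G i + G i.+2 <= 2 * G i.+1) ->
  forall i k, (i <= k <= n)%N -> i%:R * G k <= k%:R * G i.
Proof.
move=> G0 Gc.
have step i : (i < n)%N -> i%:R * G i.+1 <= i.+1%:R * G i.
  elim: i => [|i IH] ni; first by rewrite G0 mul0r mulr0.
  have h1 := IH (ltnW ni); have h2 := Gc i ni.
  have a : 0 <= i.+1%:R :> R by rewrite ler0n.
  have := ler_wpM2l a h2.
  rewrite -(natr1 i.+1); move: h1; rewrite -(natr1 i); nra.
move=> i k /andP[]; elim: k => [|k IH]; first by rewrite leqn0 => /eqP ->.
rewrite leq_eqVlt => /predU1P[-> //|ik kn].
have [i0|i0] := posnP i; first by rewrite i0 G0 mul0r mulr0.
have k0 : 0 < k%:R :> R by rewrite ltr0n (leq_trans i0).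
rewrite -(ler_pM2l k0).
have h1 := IH ik (ltnW kn); have h2 := step k kn.
have a : 0 <= i%:R :> R by [].
have b : 0 <= k.+1%:R :> R by [].
have := ler_wpM2l a h2; have := ler_wpM2l b h1; nra.
Qed.

(** The substitute for the saddle point: [x] is the geometric mean of the [m]
    ratios [p (j - 1) / p j] with [n - m < j <= n]. *)
Lemma cycle_coef_saddle n : (m <= n)%N -> exists x : R,
  [/\ 1 <= x, \sum_(i < m) x ^+ i.+1 <= n%:R &
    forall k, (m <= k <= n)%N -> p (n - k) <= p n * x ^+ k].
Proof.
move=> mn; pose G i := ln (p (n - i) / p n).
have rpos i : 0 < p (n - i) / p n by rewrite divr_gt0 ?cycle_coef_gt0.
have G0 : G 0 = 0 by rewrite /G subn0 divff ?ln1 // lt0r_neq0 ?cycle_coef_gt0.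
have Gc i : (i.+2 <= n)%N -> G i + G i.+2 <= 2 * G i.+1.
  move=> ni; have r2 := mulr_gt0 (rpos i) (rpos i.+2).
  rewrite mulr_natl -lnXn // -lnM ?posrE // ler_ln ?posrE ?r2 ?exprn_gt0 //.
  rewrite mulf_div expr_div_n expr2 ler_pM2r ?invr_gt0 ?mulr_gt0 ?cycle_coef_gt0 //.
  have -> : (n - i = (n - i.+2).+2)%N by lia.
  have -> : (n - i.+1 = (n - i.+2).+1)%N by lia.
  by rewrite mulrC cycle_coef_log_concave.
have chord := concave_chord G0 Gc.
have mR : 0 < m%:R :> R by rewrite ltr0n.
exists (expR (G m / m%:R)).
have xk k : expR (G m / m%:R) ^+ k = expR (k%:R * (G m / m%:R)) by rewrite expRM_natl.
have eG i : p (n - i) = p n * expR (G i).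
  by rewrite /G lnK ?posrE // mulrC divfK // lt0r_neq0 ?cycle_coef_gt0.
split.
- rewrite -[leLHS]expR0 ler_expR divr_ge0 // /G ln_ge0 // ler_pdivlMr ?cycle_coef_gt0 // mul1r.
  by apply: cycle_coef_noninc_le; lia.
- rewrite -(ler_pM2r (cycle_coef_gt0 n)) (cycle_coef_window mn) mulr_suml; apply: ler_sum => i _.
  rewrite eG mulrC ler_pM2l ?cycle_coef_gt0 // xk ler_expR mulrA ler_pdivrMr // mulrC [leRHS]mulrC.
  by rewrite mulrC chord // ltn_ord.
move=> k /andP[mk kn]; rewrite eG ler_pM2l ?cycle_coef_gt0 // xk ler_expR mulrA ler_pdivlMr //.
by rewrite mulrC chord // mk.
Qed.

End CycleIndexSequence.
(** * Perturbing the recurrence beyond index [m] *)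

Section Comparison.

Variable R : realType.

Lemma expR_ge_partial_sum (x : R) n : 0 <= x ->
  \sum_(r < n) x ^+ r / r`!%:R <= expR x.
Proof.
move=> x0; rewrite /expR -(big_mkord xpredT (fun r => x ^+ r / r`!%:R)).
apply: (nondecreasing_cvgn_le _ (is_cvg_series_exp_coeff x) n).
apply/nondecreasing_seqP => k; rewrite /series /= big_nat_recr //= lerDl.
exact: exp_coeff_ge0.
Qed.

(** Identities between power series up to order [n] are expressed as
    divisibility of polynomials by ['X^n]. *)
Lemma dvd_polyXn n (f : {poly R}) :
  reflect (forall k, (k < n)%N -> f`_k = 0) ('X^n %| f).
Proof.
apply: (iffP idP) => [/dvdpP[g ->] k kn|f0]; first by rewrite coefMXn kn.
rewrite -(poly_take_drop n f); have -> : take_poly n f = 0.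
  by apply/polyP => i; rewrite coef_take_poly coef0; case: ifP => // /f0.
by rewrite add0r dvdp_mull.
Qed.

Lemma sum_ord_exchange (m k : nat) (f : nat -> R) :
  \sum_(i < m | (i <= k)%N) f i = \sum_(i < k.+1) if (i < m)%N then f i else 0.
Proof.
rewrite -big_mkcond /= (big_ord_widen_cond (m + k.+1) (fun i => i <= k)%N) ?leq_addr //.
rewrite [RHS](big_ord_widen_cond (m + k.+1) (fun i => i < m)%N) ?leq_addl //.
by apply: eq_bigl => i; rewrite andbC ltnS.
Qed.

(** When [D] has no constant term this agrees with the exponential series of
    [D] up to degree [n]. *)
Definition exp_trunc (n : nat) (D : {poly R}) : {poly R} :=
  \sum_(r < n.+1) r`!%:R^-1 *: D ^+ r.

Lemma deriv_exp_trunc n (D : {poly R}) :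
  (exp_trunc n D)^`() = D^`() * \sum_(r < n) r`!%:R^-1 *: D ^+ r.
Proof.
rewrite /exp_trunc big_ord_recl derivD expr0 derivZ derivC scaler0 add0r.
rewrite mulr_sumr raddf_sum; apply: eq_bigr => r _ /=.
rewrite derivZ deriv_exp /= -scaler_nat scalerA -scalerAr; congr (_ *: _).
by rewrite /bump add1n factS natrM invfM mulrAC mulVf ?mul1r // pnatr_eq0.
Qed.

Section Convolution.

Variables (m n : nat) (p a c : nat -> R).
Hypothesis m_gt0 : (0 < m)%N.
Hypothesis p0 : p 0 = 1.
Hypothesis p_rec : forall k,
  k.+1%:R * p k.+1 = \sum_(i < m | (i <= k)%N) p (k - i).
Hypothesis a0 : a 0 = 1.
Hypothesis a_rec : forall k,
  k.+1%:R * a k.+1 = \sum_(i < k.+1) c i.+1 * a (k - i).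
Hypothesis c_ge0 : forall j, 0 <= c j.
Hypothesis c_eq1 : forall j, (0 < j <= m)%N -> c j = 1.

(** The two recurrences agree on the terms [j <= m], and the further terms of
    the recurrence of [a] are nonnegative. *)
Lemma cycle_coef_le_perturbed k : p k <= a k.
Proof.
have pg := cycle_coef_gt0 m_gt0 p0 p_rec.
elim/ltn_ind: k => -[|k] IH; first by rewrite p0 a0.
rewrite -(ler_pM2l (ltr0Sn R k)) p_rec a_rec.
have age i : (i < k.+1)%N -> 0 <= a i by move=> ik; apply: le_trans (ltW (pg i)) (IH i ik).
rewrite (sum_ord_exchange m k (fun i => p (k - i))); apply: ler_sum => i _.
case: ifP => im; first by rewrite c_eq1 // mul1r IH // ltnS leq_subr.
by rewrite mulr_ge0 // age // ltnS leq_subr.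
Qed.

Let d (j : nat) : R := if (m < j)%N then c j / j%:R else 0.
Let D : {poly R} := \poly_(j < n.+1) d j.
Let E := exp_trunc n D.
Let P : {poly R} := \poly_(j < n.+1) p j.

Let D_divX : 'X^(m.+1) %| D.
Proof.
apply/dvd_polyXn => k; rewrite ltnS coef_poly => km.
by rewrite /d (ltnNge m k) km; case: ifP.
Qed.

(** Below degree [n] the product [P * E] satisfies the differential equation
    that the recurrence of [a] expresses, so its coefficients are those of [a]. *)
Let a_coef k : (k <= n)%N -> a k = (P * E)`_k.
Proof.
pose Q : {poly R} := \poly_(i < n) c i.+1.
have dvdE : 'X^n %| E^`() - D^`() * E.
  rewrite /E deriv_exp_trunc /exp_trunc big_ord_recr /= mulrDr opprD addrA subrr sub0r.
  rewrite dvdpNr dvdp_mull // dvdpZr ?invr_eq0 ?pnatr_eq0 ?gtn_eqF ?fact_gt0 //.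
  apply: dvdp_exp2r; apply: dvdp_trans D_divX.
  exact: (@dvdp_exp2l _ 'X 1 m.+1).
have dvdP : 'X^n %| P^`() - P * (Q - D^`()).
  apply/dvd_polyXn => j jn; apply/eqP; rewrite coefB subr_eq0; apply/eqP.
  rewrite coef_deriv coef_poly ltnS jn -mulr_natl p_rec.
  rewrite (sum_ord_exchange m j (fun i => p (j - i))) coefMr.
  apply: eq_bigr => i _; rewrite coef_poly coefB coef_deriv !coef_poly.
  have ij : (i <= j)%N by rewrite -ltnS ltn_ord.
  rewrite ltnS (leq_trans (leq_subr _ _)) ?(ltnW jn) // (leq_ltn_trans ij jn) ltnS.
  rewrite (leq_ltn_trans ij jn) /d ltnS; case: ltnP => im.
    by rewrite mul0rn subr0 c_eq1 // mulr1.
  by rewrite -(mulr_natr (c i.+1 / _)) divfK ?pnatr_eq0 // subrr mulr0.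
have dvdA : 'X^n %| (P * E)^`() - Q * (P * E).
  have -> : (P * E)^`() - Q * (P * E) =
      (P^`() - P * (Q - D^`())) * E + P * (E^`() - D^`() * E).
    by rewrite derivM; ring.
  by apply: dvdp_add; [apply: dvdp_mulr | apply: dvdp_mull].
elim/ltn_ind: k => -[_ _|k IH kn].
  rewrite a0 coef0M coef_poly p0 mul1r /E /exp_trunc big_ord_recl coefD.
  rewrite fact0 invr1 scale1r coefC eqxx /= coef_sum big1 ?addr0 // => i _.
  rewrite coefZ exprS; apply/eqP; rewrite mulf_eq0; apply/orP; right.
  by rewrite coef0M coef_poly /d ltn0 mul0r.
apply: (mulfI (lt0r_neq0 (ltr0Sn R k))); rewrite a_rec.
have := dvd_polyXn _ _ dvdA k kn; rewrite coefB coef_deriv mulr_natl => /eqP.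
rewrite subr_eq0 => /eqP ->; rewrite coefM; apply: eq_bigr => i _.
have ik : (i <= k)%N by rewrite -ltnS ltn_ord.
by rewrite coef_poly (leq_ltn_trans ik kn) -IH ?ltnS ?leq_subr // (leq_trans (leq_subr _ _)) // ltnW.
Qed.

Let E_nneg k : 0 <= E`_k.
Proof.
rewrite /E /exp_trunc coef_sum sumr_ge0 // => r _; rewrite coefZ mulr_ge0 ?invr_ge0 //.
elim: (nat_of_ord r) k => [|i IH] k; first by rewrite expr0 coef1 ler0n.
rewrite exprS coefM sumr_ge0 // => j _; rewrite mulr_ge0 // coef_poly /d.
by case: ifP => // _; case: ifP => // _; rewrite divr_ge0.
Qed.

Let E_gap k : (0 < k <= m)%N -> E`_k = 0.
Proof.
case/andP=> k0 km.
have /dvd_polyXn : 'X^(m.+1) %| E - 1.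
  rewrite /E /exp_trunc big_ord_recl /= fact0 invr1 scale1r expr0 addrAC subrr add0r.
  apply: (big_ind (fun f : {poly R} => 'X^(m.+1) %| f)) => [||r _].
  - exact: dvdp0.
  - by move=> f g; apply: dvdp_add.
  by rewrite dvdpZr ?invr_eq0 ?pnatr_eq0 ?gtn_eqF ?fact_gt0 // (exprS D) dvdp_mulr.
by move=> /(_ k km); rewrite coefB coefC gtn_eqF // subr0.
Qed.

(** In [a n = sum_k p (n - k) E_k] the coefficient [E_k] vanishes for
    [1 <= k <= m], so every [p (n - k)] may be replaced by [p n * x ^+ k]; what
    remains is at most [p n * E.[x]], a partial sum of an exponential. *)
Lemma perturbed_le_expR (x : R) : 0 <= x ->
  (forall k, (m <= k <= n)%N -> p (n - k) <= p n * x ^+ k) ->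
  a n <= p n * expR (\sum_(m.+1 <= j < n.+1) c j / j%:R * x ^+ j).
Proof.
move=> x0 px; have pg := cycle_coef_gt0 m_gt0 p0 p_rec.
have Dx : D.[x] = \sum_(m.+1 <= j < n.+1) c j / j%:R * x ^+ j.
  rewrite horner_poly -(big_mkord xpredT (fun j => d j * x ^+ j)).
  have [mn|nm] := leqP m n.
    rewrite (@big_cat_nat _ _ _ m.+1) //= big_nat_cond big1 ?add0r.
      by apply: eq_big_nat => j /andP[mj _]; rewrite /d mj.
    by move=> j /andP[/andP[_ jm] _]; rewrite /d (ltnNge m j) -ltnS jm mul0r.
  rewrite [RHS]big_geq ?ltnS ?(ltnW nm) // big_nat_cond big1 // => j.
  case/andP=> /andP[_ jn] _.
  by rewrite /d (ltnNge m j) (leq_trans _ (ltnW nm)) ?mul0r.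
have D0 : 0 <= D.[x].
  by rewrite Dx sumr_ge0 // => j _; rewrite mulr_ge0 ?exprn_ge0 // divr_ge0.
rewrite -Dx; apply: (@le_trans _ _ (p n * E.[x])); last first.
  rewrite ler_pM2l // /E /exp_trunc horner_sum; apply: le_trans (expR_ge_partial_sum n.+1 D0).
  by apply: ler_sum => r _; rewrite hornerZ horner_exp mulrC.
apply: (@le_trans _ _ (\sum_(k < n.+1) p n * (E`_k * x ^+ k))).
  rewrite a_coef // coefMr; apply: ler_sum => k _.
  have kn : (k <= n)%N by rewrite -ltnS ltn_ord.
  rewrite coef_poly ltnS leq_subr mulrCA [leLHS]mulrC.
  have [k0|k0] := posnP k; first by rewrite k0 subn0 expr0 mulr1.
  have [km|mk] := leqP k m; first by rewrite E_gap ?k0 // !mul0r.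
  by rewrite ler_wpM2l // px // ltnW.
rewrite -mulr_sumr ler_pM2l // (horner_coef_wide x (leq_maxl (size E) n.+1)).
rewrite (big_ord_widen _ (fun k => E`_k * x ^+ k) (leq_maxr (size E) n.+1)).
rewrite big_mkcond /=; apply: ler_sum => k _.
by case: ifP => // _; rewrite mulr_ge0 // exprn_ge0.
Qed.

End Convolution.

End Comparison.
(** * Bounding the exponent at the saddle point *)

Section TailBound.

Variable R : realType.

Lemma ln_le_subr1 (x : R) : 0 < x -> ln x <= x - 1.
Proof. by move=> x0; have := @le_ln1Dx R (x - 1); rewrite [1 + _]addrC subrK; apply; lra. Qed.

Lemma ln2_ge_half : 1 / 2 <= ln (2 : R).
Proof.
have := @ln_le_subr1 (2^-1); rewrite lnV ?posrE // invr_gt0 ltr0n => /(_ isT).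
lra.
Qed.

(** Summing the geometric series, [x ^+ m - 1] is [1 - x^-1] times the sum on the
    left, and [1 - x^-1 <= ln x = ln (x ^+ m) / m]. *)
Lemma saddle_ln (n m : nat) (x : R) : (0 < m)%N -> 1 <= x ->
  \sum_(i < m) x ^+ i.+1 <= n%:R ->
  x ^+ m - 1 <= n%:R / m%:R * ln (x ^+ m).
Proof.
move=> m0 x1 sx; have x0 : 0 < x by lra.
rewrite lnXn // -(mulr_natl (ln x)) mulrA divfK ?pnatr_eq0 -?lt0n //.
rewrite subrX1; have h := ln_le_subr1 (_ : 0 < x^-1).
have {h} lx : 1 - x^-1 <= ln x.
  by have := h; rewrite invr_gt0 lnV ?posrE // => /(_ x0); lra.
have n0 : 0 <= n%:R :> R by [].
apply: le_trans (ler_wpM2l n0 lx).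
have -> : (x - 1) * \sum_(i < m) x ^+ i = (1 - x^-1) * \sum_(i < m) x ^+ i.+1.
  have -> : \sum_(i < m) x ^+ i.+1 = x * \sum_(i < m) x ^+ i.
    by rewrite mulr_sumr; apply: eq_bigr => i _; rewrite exprS.
  by rewrite mulrA; congr (_ * _); rewrite mulrBl mul1r mulVf ?lt0r_neq0.
rewrite mulrC ler_wpM2r // subr_ge0 invf_le1 //.
Qed.

(** With [r] the square root of [t], [ln t = 2 ln r <= 2 (r - 1)] turns the
    hypothesis into [r <= 2 u]; thus [ln t <= 2 ln (2 u)], which the hypothesis
    converts into the bound on [t]. *)
Lemma le_of_ln_bound (u t : R) : 1 <= u -> 1 <= t -> t - 1 <= u * ln t ->
  t <= 6 * (u * ln (u + 1)).
Proof.
move=> u1 t1 h; set r := Num.sqrt t.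
have tr : t = r ^+ 2 by rewrite sqr_sqrtr //; lra.
have r1 : 1 <= r by rewrite -sqrtr1 ler_wsqrtr.
have r0 : 0 < r by lra.
have lt : ln t = 2 * ln r by rewrite tr lnXn // mulr_natl.
have lr := ln_le_subr1 r0.
have r2u : r <= 2 * u.
  have [r_1|r_1] := eqVneq r 1; first by rewrite r_1; lra.
  have r_2 : 0 < r - 1 by rewrite subr_gt0 lt_neqAle eq_sym r_1.
  have : (r - 1) * (r + 1) <= (r - 1) * (2 * u).
    rewrite lt in h; nra.
  rewrite ler_pM2l //; lra.
have l2u : ln r <= 2 * ln (u + 1).
  have -> : 2 * ln (u + 1) = ln ((u + 1) ^+ 2) by rewrite lnXn ?mulr_natl //; lra.
  rewrite ler_ln ?posrE //; nra.
have l2 : 1 / 2 <= ln (u + 1).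
  apply: le_trans ln2_ge_half _; rewrite ler_ln ?posrE //; lra.
rewrite lt in h.
have : u * (2 * ln r) <= u * (4 * ln (u + 1)) by rewrite ler_pM2l; lra.
have : 1 / 2 <= u * ln (u + 1) by nra.
lra.
Qed.

Lemma sqr_le_expn2 (m : nat) : (m ^ 2 <= 4 * 2 ^ m)%N.
Proof.
elim: m => // m; case: (leqP 3 m) => [m3|]; last by case: m => [|[|[|]]].
rewrite (expnS 2 m); nia.
Qed.

Lemma double_minn_half (m j : nat) : (2 * minn m j./2 <= j)%N.
Proof. lia. Qed.

(** The gap [1 - z] is at least [(1 - z ^+ m) / m >= 1 / (2 m)]. *)
Lemma geometric_tail (z : R) (m a b : nat) : (0 < m)%N -> 0 <= z -> z ^+ m <= 1 / 2 ->
  \sum_(a <= j < b) z ^+ j <= (2 * m%:R) * z ^+ a.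
Proof.
move=> m0 z0 zm.
have z1 : z < 1.
  rewrite ltNge; apply/negP => z1; have := exprn_ege1 m z1; lra.
have gap : 1 / 2 <= m%:R * (1 - z).
  have : 1 - z ^+ m <= m%:R * (1 - z).
    have Sm : \sum_(i < m) z ^+ i <= m%:R.
      rewrite -[m in leRHS]card_ord -sumr_const; apply: ler_sum => i _.
      by rewrite exprn_ile1 // ltW.
    have := subrX1 z m; nra.
  lra.
have [ab|ba] := leqP a b; last first.
  by rewrite big_geq ?(ltnW ba) // mulr_ge0 ?exprn_ge0 // mulr_ge0.
have S0 : 0 <= \sum_(a <= j < b) z ^+ j by rewrite sumr_ge0 // => j _; rewrite exprn_ge0.
have : (1 - z) * \sum_(a <= j < b) z ^+ j <= z ^+ a.
  rewrite mulr_sumr (eq_bigr (fun j => - z ^+ j.+1 - (- z ^+ j))); last first.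
    by move=> j _; rewrite exprS; ring.
  rewrite (telescope_sumr (fun j => - z ^+ j)) //.
  have := exprn_ge0 b z0; lra.
have mR : 0 <= m%:R :> R by [].
move=> /(ler_wpM2l mR); nra.
Qed.

Lemma ln_ge2 (n : nat) : (16 <= n)%N -> 2 <= ln (n%:R : R).
Proof.
move=> n16; apply: (@le_trans _ _ (ln ((2 : R) ^+ 4))).
  by rewrite lnXn // -(mulr_natl (ln 2)); have := ln2_ge_half; lra.
rewrite ler_ln ?posrE ?exprn_gt0 // ?ltr0n ?(leq_trans _ n16) //.
by rewrite -natrX ler_nat.
Qed.

(** With [u = n / m], the left side is [n ln (u + 1) <= 2 n ln n], since
    [u + 1 <= n ^+ 2]. *)
Lemma smoothness_bound_le (q n m : nat) :
  (2 <= n)%N -> (0 < m)%N -> n%:R * ln (n%:R : R) <= q%:R ^+ m ->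
  n%:R / m%:R * ln (n%:R / m%:R + 1) * m%:R <= 2 * q%:R ^+ m :> R.
Proof.
move=> n2 m0 hq; set u := n%:R / m%:R.
have mR : 1 <= m%:R :> R by rewrite ler1n.
have nR : 2 <= n%:R :> R by rewrite (ler_nat R 2).
have uE : u * m%:R = n%:R by rewrite divfK // lt0r_neq0 //; lra.
have un : u <= n%:R by rewrite ler_pdivrMr; nra.
have u0 : 0 < u by rewrite divr_gt0; lra.
have lu : ln (u + 1) <= 2 * ln n%:R.
  rewrite mulr_natl -lnXn; last by lra.
  rewrite ler_ln ?posrE; [nra|lra|nra].
rewrite mulrAC uE; apply: le_trans (_ : n%:R * (2 * ln n%:R) <= _).
  by rewrite ler_wpM2l.
lra.
Qed.

Lemma saddle_tail_small (b n m : nat) (x : R) (c : nat -> R) :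
  (n <= b)%N -> (0 < m)%N -> 1 <= x -> x ^+ m <= n%:R ->
  (forall j, 0 <= c j <= 1) ->
  \sum_(m.+1 <= j < n.+1) c j / j%:R * x ^+ j <= b%:R ^+ b.+1.
Proof.
move=> nb m0 x1 xn c01; have x0 : 0 <= x by lra.
have xb : x <= b%:R.
  by rewrite (le_trans (ler_eXnr m0 x1)) // (le_trans xn) // ler_nat.
apply: (@le_trans _ _ (\sum_(m.+1 <= j < n.+1) b%:R ^+ b)).
  rewrite big_nat_cond [leRHS]big_nat_cond; apply: ler_sum => j.
  rewrite andbT ltnS => /andP[mj jn].
  have j1 : 1 <= j%:R :> R by rewrite ler1n (leq_ltn_trans _ mj).
  have /andP[cj0 cj1] := c01 j.
  have cj : c j / j%:R <= 1 by rewrite ler_pdivrMr ?mul1r; lra.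
  have h := ler_wpM2r (exprn_ge0 j x0) cj; rewrite mul1r in h.
  apply: le_trans h (le_trans (lerXn2r j _ _ xb) _); rewrite ?nnegrE //.
  by rewrite ler_weXn2l ?ler1n ?(leq_trans jn) // (leq_trans _ nb) // (leq_trans _ jn) // (leq_trans _ mj).
rewrite sumr_const_nat subSS -(mulr_natl (_ ^+ b)) [leRHS]exprS.
by rewrite ler_wpM2r ?exprn_ge0 // ler_nat (leq_trans (leq_subr _ _)).
Qed.

(** Here [z = x / q] must stay away from [1] for the far terms to be summable
    independently of [n].  From [x ^+ m <= n] and [q ^+ m >= n ln n] one gets
    [z ^+ m <= 1 / ln n <= 1 / 2] as soon as [n >= 16]; the finitely many smaller
    [n] are absorbed into the constant. *)
Lemma saddle_tail_bound : exists C : R, 0 < C /\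
  forall (q n m : nat) (x : R) (c : nat -> R),
    (2 <= q)%N -> (2 <= n)%N -> (0 < m <= n)%N -> 1 <= x ->
    \sum_(i < m) x ^+ i.+1 <= n%:R ->
    n%:R * ln (n%:R : R) <= q%:R ^+ m ->
    (forall j, 0 <= c j <= 1) ->
    (forall j, (m < j)%N -> c j <= 2 * q%:R ^+ minn m j./2 / q%:R ^+ j) ->
    \sum_(m.+1 <= j < n.+1) c j / j%:R * x ^+ j <=
      C * (n%:R / m%:R * ln (n%:R / m%:R + 1) / m%:R).
Proof.
have [K [K0 HK]] : exists K : R, 0 <= K /\
    forall (n m : nat) (x : R) (c : nat -> R),
    (n <= 15)%N -> (0 < m)%N -> 1 <= x -> x ^+ m <= n%:R ->
    (forall j, 0 <= c j <= 1) ->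
    \sum_(m.+1 <= j < n.+1) c j / j%:R * x ^+ j <= K.
  by exists (15%:R ^+ 16); split; [rewrite exprn_ge0 | exact: saddle_tail_small].
exists (456 + 30 * K); split; first by lra.
move=> q n m x c q2 n2 /andP[m0 mn] x1 sx hq c01 cq.
set u := n%:R / m%:R; set V := u * ln (u + 1).
have mR : 1 <= m%:R :> R by rewrite ler1n.
have qR : 2 <= q%:R :> R by rewrite (ler_nat R 2).
have nR : 2 <= n%:R :> R by rewrite (ler_nat R 2).
have u1 : 1 <= u by rewrite ler_pdivlMr ?mul1r ?ler_nat //; lra.
have V0 : 1 / 2 <= V.
  have l2 : 1 / 2 <= ln (u + 1).
    apply: le_trans ln2_ge_half _; rewrite ler_ln ?posrE //; lra.
  rewrite /V; nra.
set t := x ^+ m.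
have t1 : 1 <= t by rewrite exprn_ege1.
have t6 : t <= 6 * V by apply: le_of_ln_bound => //; exact: saddle_ln.
have tn : t <= n%:R.
  apply: le_trans sx; case: m m0 @t {mn hq cq u V V0 mR u1 t1 t6} => // m _.
  rewrite big_ord_recr /= lerDr sumr_ge0 // => i _; rewrite exprn_ge0 //; lra.
have c_nn j : 0 <= c j by case/andP: (c01 j).
have c_le1 j : c j <= 1 by case/andP: (c01 j).
have x0 : 0 < x by lra.
have VW : V = V / m%:R * m%:R by rewrite divfK // lt0r_neq0 //; lra.
have W0 : 0 <= V / m%:R by rewrite divr_ge0 //; lra.
move: VW W0; set W := V / m%:R => VW W0.
have KW0 : 0 <= K * W by rewrite mulr_ge0.
have [n16|n16] := ltnP n 16.
  have hK := HK n m x c n16 m0 x1 tn c01; apply: le_trans hK _.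
  have m15 : m%:R <= 15 :> R by rewrite (ler_nat R _ 15) (leq_trans mn).
  have W30 : 1 / 30 <= W by nra.
  nra.
have tq : t * m%:R <= 12 * q%:R ^+ m.
  have := smoothness_bound_le n2 m0 hq; rewrite -/u -/V => hV.
  have : t * m%:R <= 6 * V * m%:R by rewrite ler_wpM2r //; lra.
  lra.
set s := Num.sqrt (q%:R : R).
have s2 : s ^+ 2 = q%:R by rewrite sqr_sqrtr.
have s1 : 1 <= s by rewrite -[leLHS]sqrtr1 ler_wsqrtr //; lra.
have s0 : 0 < s by lra.
have q0 : 0 < q%:R :> R by lra.
have sm2 : (s ^+ m) ^+ 2 = q%:R ^+ m by rewrite -exprM mulnC exprM s2.
have Q0 : 0 < q%:R ^+ m :> R by rewrite exprn_gt0.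
have sm0 : 0 < s ^+ m by rewrite exprn_gt0.
have sm : m%:R <= 2 * s ^+ m.
  have : m%:R ^+ 2 <= 4 * q%:R ^+ m :> R.
    rewrite -!natrX -(natrM R 4) ler_nat (leq_trans (sqr_le_expn2 m)) //.
    by rewrite leq_mul2l /= leq_exp2r.
  rewrite -sm2 => h; rewrite leNgt; apply/negP; nra.
set z := x / q%:R.
have z0 : 0 <= z by rewrite divr_ge0 // ltW.
have zmE : z ^+ m = t / q%:R ^+ m by rewrite /z expr_div_n.
have zm : z ^+ m <= 1 / 2.
  rewrite zmE ler_pdivrMr //; have := ln_ge2 n16; nra.
pose A : R := 2 / m%:R * (t / s ^+ m + t ^+ 2 / q%:R ^+ m).
pose B : R := 2 * q%:R ^+ m / m%:R.
have B0 : 0 <= B by rewrite divr_ge0 ?mulr_ge0 // ltW.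
have A0 : 0 <= A.
  by rewrite mulr_ge0 ?divr_ge0 // addr_ge0 // divr_ge0 ?exprn_ge0 // ltW // (lt_le_trans _ t1).
have jm j : (m < j)%N -> c j / j%:R * x ^+ j <= c j / m%:R * x ^+ j.
  move=> mj; rewrite ler_wpM2r ?exprn_ge0 ?(ltW x0) // ler_wpM2l //.
  have mp : 0 < m%:R :> R by lra.
  have mj' : m%:R <= j%:R :> R by rewrite ler_nat ltnW.
  by rewrite lef_pV2 ?posrE //; apply: lt_le_trans mj'.
(* On [m < j <= 2 m] the powers of [x / s], with [s ^+ 2 = q], are at most the
   sum of the two extreme ones. *)
have near j : (m < j <= 2 * m)%N -> c j / j%:R * x ^+ j <= A.
  case/andP=> mj jm2; apply: le_trans (jm j mj) _.
  have cj : c j <= 2 / s ^+ j.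
    apply: le_trans (cq j mj) _; rewrite -!mulrA ler_wpM2l // ler_pdivrMr ?exprn_gt0 //.
    rewrite mulrC ler_pdivlMr ?exprn_gt0 // -s2 -!exprM -exprD ler_weXn2l //.
    by rewrite (mul2n j) -addnn leq_add2r double_minn_half.
  have rj : (x / s) ^+ j <= t / s ^+ m + t ^+ 2 / q%:R ^+ m.
    have -> : t / s ^+ m = (x / s) ^+ m by rewrite expr_div_n.
    have -> : t ^+ 2 / q%:R ^+ m = (x / s) ^+ (2 * m).
      by rewrite expr_div_n -s2 -!exprM [(m * 2)%N]mulnC.
    have r0 : 0 <= x / s by rewrite divr_ge0 // ltW.
    have [r1|r1] := leP (x / s) 1.
      by rewrite ler_wpDr ?exprn_ge0 // ler_wiXn2l // ltnW.
    by rewrite ler_wpDl ?exprn_ge0 // ler_weXn2l // ltW.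
  have mi : 0 <= m%:R^-1 :> R by rewrite invr_ge0.
  have xj : 0 <= x ^+ j by rewrite exprn_ge0 // ltW.
  apply: (@le_trans _ _ (2 / s ^+ j / m%:R * x ^+ j)).
    by rewrite ler_wpM2r // ler_wpM2r.
  rewrite /A [leLHS](_ : _ = 2 / m%:R * (x / s) ^+ j); last first.
    by rewrite expr_div_n; ring.
  by rewrite ler_wpM2l // mulr_ge0.
(* Beyond [2 m] only [c j <= 2 q ^+ m / q ^+ j] is used, and the terms decay
   geometrically. *)
have far j : (2 * m < j)%N -> c j / j%:R * x ^+ j <= B * z ^+ j.
  move=> mj; have mj' : (m < j)%N by rewrite (leq_ltn_trans _ mj) // leq_pmull.
  apply: le_trans (jm j mj') _.
  have xj : 0 <= x ^+ j by rewrite exprn_ge0 // ltW.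
  have mi : 0 <= m%:R^-1 :> R by rewrite invr_ge0.
  have := cq j mj'; rewrite (minn_idPl _); last first.
    by rewrite geq_half_double -mul2n ltnW.
  move=> cj; apply: (@le_trans _ _ (2 * q%:R ^+ m / q%:R ^+ j / m%:R * x ^+ j)).
    by rewrite ler_wpM2r // ler_wpM2r.
  by rewrite /B /z expr_div_n le_eqVlt; apply/orP; left; apply/eqP; ring.
pose g j := if (j <= 2 * m)%N then A else B * z ^+ j.
have g0 j : 0 <= g j.
  by rewrite /g; case: ifP => // _; rewrite mulr_ge0 // exprn_ge0.
have total : \sum_(m.+1 <= j < n.+1) c j / j%:R * x ^+ j <=
    m%:R * A + B * (2 * m%:R * z ^+ (2 * m)).
  apply: (@le_trans _ _ (\sum_(m.+1 <= j < (n + 2 * m).+1) g j)).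
    rewrite [leRHS](@big_cat_nat _ _ _ n.+1) ?ltnS ?leq_addr //=.
    rewrite ler_wpDr ?sumr_ge0 // big_nat_cond [leRHS]big_nat_cond.
    apply: ler_sum => j; rewrite andbT => /andP[mj _]; rewrite /g.
    by case: leqP => jm2; [apply: near; rewrite mj | apply: far].
  rewrite (@big_cat_nat _ _ _ (2 * m).+1) ?ltnS ?leq_addl ?leq_pmull //=.
  apply: lerD.
    rewrite (eq_big_nat _ _ (F2 := fun=> A)) => [|j /andP[_]]; last first.
      by rewrite /g ltnS => ->.
    by rewrite sumr_const_nat -(mulr_natl A) subSS mul2n -addnn addnK.
  rewrite (eq_big_nat _ _ (F2 := fun j => B * z ^+ j)) => [|j /andP[mj _]]; last first.
    by rewrite /g leqNgt mj.
  rewrite -mulr_sumr ler_wpM2l //; apply: le_trans (geometric_tail _ _ m0 z0 zm) _.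
  rewrite ler_wpM2l ?mulr_ge0 // exprS ler_piMl ?exprn_ge0 //.
  rewrite leNgt; apply/negP=> z1; have := exprn_ege1 m (ltW z1); lra.
apply: le_trans total _.
have -> : m%:R * A + B * (2 * m%:R * z ^+ (2 * m)) =
    2 * (t / s ^+ m) + 6 * (t ^+ 2 / q%:R ^+ m).
  rewrite mulnC exprM zmE /A /B; field.
  by rewrite !lt0r_neq0 //; lra.
rewrite VW in t6.
have h1 : t / s ^+ m <= 12 * W.
  rewrite ler_pdivrMr //; have := ler_wpM2l W0 sm; lra.
have h2 : t ^+ 2 / q%:R ^+ m <= 72 * W.
  rewrite ler_pdivrMr //; have T0 : 0 <= t by lra.
  have := ler_wpM2l T0 t6; have := ler_wpM2l W0 tq; lra.
lra.
Qed.

End TailBound.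
(** * The theorem *)

Section PolyProbability.

Variables (R : realType) (F : finFieldType) (m : nat).
Let q := #|F|.

Definition density_smooth_poly (n : nat) : R :=
  (num_smooth_poly F m n)%:R / q%:R ^+ n.

Definition mangoldt_density (j : nat) : R := (mangoldt F m j)%:R / q%:R ^+ j.

Let q_gt1 : (1 < q)%N. Proof. exact: card_finNzRing_gt1. Qed.

Let qX_gt0 n : 0 < q%:R ^+ n :> R.
Proof. by rewrite exprn_gt0 // ltr0n ltnW. Qed.

Lemma prob_smooth_polyE n : prob_smooth_poly R F n m = density_smooth_poly n.
Proof.
rewrite /prob_smooth_poly /uniform_prob card_monic_polys natrX; congr (_%:R / _).
rewrite /num_smooth_poly count_map -size_filter cardE; congr size.
by rewrite {1 2}/enum_mem -filter_predI; apply: eq_filter => f; rewrite !inE andbC.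
Qed.

Lemma density_smooth_poly0 : density_smooth_poly 0 = 1.
Proof. by rewrite /density_smooth_poly num_smooth_poly_full // divr1. Qed.

Lemma density_smooth_poly_rec n :
  n.+1%:R * density_smooth_poly n.+1 =
  \sum_(i < n.+1) mangoldt_density i.+1 * density_smooth_poly (n - i).
Proof.
rewrite /density_smooth_poly mulrA -natrM num_smooth_poly_rec big_add1 /= big_mkord.
rewrite natr_sum mulr_suml; apply: eq_bigr => i _.
have qX : q%:R ^+ n.+1 = q%:R ^+ i.+1 * q%:R ^+ (n - i) :> R.
  by rewrite -exprD addSn subnKC // -ltnS.
by rewrite subSS /mangoldt_density natrM qX invfM mulrACA.
Qed.

Lemma mangoldt_density_ge0 j : 0 <= mangoldt_density j.
Proof. by rewrite divr_ge0 // ltW. Qed.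

Lemma mangoldt_density_small j : (0 < j <= m)%N -> mangoldt_density j = 1.
Proof. by move=> jm; rewrite /mangoldt_density mangoldt_small // natrX divff ?lt0r_neq0. Qed.

Lemma mangoldt_density_le1 j : mangoldt_density j <= 1.
Proof.
rewrite ler_pdivrMr // mul1r -natrX ler_nat.
by case: j => [|j]; [rewrite /mangoldt big_geq | exact: mangoldt_le].
Qed.

Lemma mangoldt_density_large j : (m < j)%N ->
  mangoldt_density j <= 2 * q%:R ^+ minn m j./2 / q%:R ^+ j.
Proof.
move=> mj; rewrite ler_wpM2r ?invr_ge0 ?(ltW (qX_gt0 _)) // -natrX -(natrM R 2) ler_nat.
exact: mangoldt_large.
Qed.

End PolyProbability.

Unset Implicit Arguments.

Theorem theorem1p10 (R : realType) :
  exists C : R, 0 < C /\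
    forall (q : nat) (F : finFieldType) (n m : nat),
      #|F| = q -> (2 <= n)%N -> (1 <= m)%N -> (m <= n)%N ->
      ln (n%:R * ln (n%:R : R)) / ln (q%:R : R) <= m%:R ->
      let u : R := n%:R / m%:R in
      expR (- C * (u * ln (u + 1) / m%:R))
        <= prob_smooth_poly R F n m / prob_smooth_perm R n m
        <= expR (C * (u * ln (u + 1) / m%:R)).
Proof.
have [C [C0 HC]] := saddle_tail_bound R; exists C; split=> //.
move=> _ F n m <- n2 m1 mn hq /=; set u : R := n%:R / m%:R.
have q2 : (2 <= #|F|)%N by exact: card_finNzRing_gt1.
have nR : 2 <= n%:R :> R by rewrite (ler_nat R 2).
have qR : 2 <= #|F|%:R :> R by rewrite (ler_nat R 2).
have hq' : n%:R * ln (n%:R : R) <= #|F|%:R ^+ m.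
  have lq : 0 < ln (#|F|%:R : R) by rewrite ln_gt0 //; lra.
  have ln_n : 0 < ln (n%:R : R) by rewrite ln_gt0 //; lra.
  move: hq; rewrite ler_pdivrMr // [leRHS]mulr_natl -lnXn; last by lra.
  rewrite ler_ln ?posrE ?exprn_gt0 ?mulr_gt0 //; lra.
pose p k := prob_smooth_perm R k m.
have p0 : p 0 = 1 := prob_smooth_perm0 R m.
have p_rec k : k.+1%:R * p k.+1 = \sum_(i < m | (i <= k)%N) p (k - i)%N.
  exact: prob_smooth_perm_rec.
have p_gt0 := cycle_coef_gt0 m1 p0 p_rec.
have [x [x1 x_sum px]] := cycle_coef_saddle m1 p0 p_rec mn.
have a0 := density_smooth_poly0 R F m.
have a_rec := density_smooth_poly_rec R F m.
have c_ge0 := mangoldt_density_ge0 R F m.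
have c_eq1 := @mangoldt_density_small R F m.
have lower := cycle_coef_le_perturbed m1 p0 p_rec a0 a_rec c_ge0 c_eq1 n.
have x0 : 0 <= x by lra.
have upper := perturbed_le_expR m1 p0 p_rec a0 a_rec c_ge0 c_eq1 x0 px.
have mR : 0 < m%:R :> R by rewrite ltr0n.
have V0 : 0 <= u * ln (u + 1) / m%:R.
  have u0 : 0 <= u by rewrite divr_ge0 // ltW.
  by rewrite divr_ge0 ?(ltW mR) // mulr_ge0 // ln_ge0 // lerDr.
rewrite prob_smooth_polyE -/(p n); apply/andP; split.
  apply: (@le_trans _ _ 1); last by rewrite ler_pdivlMr ?mul1r.
  by rewrite expR_le1 mulNr oppr_le0 mulr_ge0 // ltW.
rewrite ler_pdivrMr // mulrC; apply: le_trans upper _.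
rewrite ler_pM2l // ler_expR; apply: (HC #|F|) => //.
- by rewrite m1.
- by move=> j; rewrite c_ge0 mangoldt_density_le1.
- exact: mangoldt_density_large.
Qed.
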